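(* Let $P$ and $Q$ be two orthogonal projections on a Hilbert space $\mathcal{H}$ in the generic position, written with respect to $\mathcal{H}=\mathcal{H}_5\oplus\mathcal{H}_6$, where $\mathcal{H}_5=\mathcal{R}(P)$ and $\mathcal{H}_6=\mathcal{N}(P)$, as $$P=I_5\oplus 0I_6,\qquad Q=\begin{pmatrix} Q_0 & Q_0^{1/2}(I_5-Q_0)^{1/2}D\\ D^*Q_0^{1/2}(I_5-Q_0)^{1/2} & D^*(I_5-Q_0)D\end{pmatrix},$$ where $Q_0$ is a positive contraction on $\mathcal{H}_5$ for which neither $0$ nor $1$ is an eigenvalue, and $D$ is a unitary from $\mathcal{H}_6$ onto $\mathcal{H}_5$. Then, with respect to the same decomposition: (a) $$\mathrm{out}\,\mathcal{U}_Q(P)=\left\{\begin{pmatrix}Q_0^{1/2} & (I_5-Q_0)^{1/2}D\\ D^*(I_5-Q_0)^{1/2} & -D^*Q_0^{1/2}D\end{pmatrix}\begin{pmatrix}U_0&0\\0&S_0\end{pmatrix} : U_0\in\mathcal{U}(\mathcal{H}_5),\ S_0\in\mathcal{U}(\mathcal{H}_6)\right\}.$$ (b) $$\mathrm{int}\,\mathcal{U}_Q(P)=\left\{\begin{pmatrix}Q_0^{1/2} & (I_5-Q_0)^{1/2}D\\ D^*(I_5-Q_0)^{1/2} & -D^*Q_0^{1/2}D\end{pmatrix}\begin{pmatrix}U_0&0\\0&D^*U_0D\end{pmatrix} : U_0\in\mathcal{U}(\mathcal{H}_5),\ U_0Q_0=Q_0U_0\right\}.$$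
   Context: For a Hilbert space $\mathcal{K}$, $\mathcal{U}(\mathcal{K})$ denotes the set of all unitary operators on $\mathcal{K}$; $\mathcal{R}(A)$ and $\mathcal{N}(A)$ denote the range and null space of an operator $A$; $I_i$ is the identity on $\mathcal{H}_i$. An orthogonal projection is a bounded operator $P$ with $P=P^*=P^2$. For orthogonal projections $P,Q$ on $\mathcal{H}$, the set of outer intertwining operators is $\mathrm{out}\,\mathcal{U}_Q(P)=\{U\in\mathcal{U}(\mathcal{H}): UP=QU\}$, and the set of intertwining operators is $\mathrm{int}\,\mathcal{U}_Q(P)=\{U\in\mathcal{U}(\mathcal{H}): UP=QU \text{ and } PU=UQ\}$. The pair $(P,Q)$ is in the generic position if $\mathcal{R}(P)\cap\mathcal{R}(Q)$, $\mathcal{R}(P)\cap\mathcal{N}(Q)$, $\mathcal{N}(P)\cap\mathcal{R}(Q)$ and $\mathcal{N}(P)\cap\mathcal{N}(Q)$ are all $\{0\}$. It is a known fact that every pair in the generic position admits operator matrices of the form displayed in the claim. *)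

(* Defs.v *)
From HB Require Import structures.
From mathcomp Require Import all_boot all_order all_algebra sesquilinear.
From mathcomp Require Import complex.
From mathcomp Require Import all_classical all_reals all_analysis.

Set Implicit Arguments.
Unset Strict Implicit.
Unset Printing Implicit Defensive.

Import Order.TTheory GRing.Theory Num.Theory.
Import numFieldNormedType.Exports.

Local Open Scope classical_set_scope.
Local Open Scope complex_scope.
Local Open Scope ring_scope.

HB.mixin Record CompleteNormedModule_isHilbert (R : realType) H
    & CompleteNormedModule R[i] H := {
  dotp : {dot H for (@Num.conj R[i])} ;
  normr_dotp : forall x : H, `|x| ^+ 2 = dotp x x
}.

#[short(type="hilbertType")]
HB.structure Definition Hilbert (R : realType) :=
  {H of CompleteNormedModule R[i] H & CompleteNormedModule_isHilbert R H}.

Record closedSubspace (R : realType) (H : hilbertType R) := ClosedSubspace {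
  subspace_set : set H ;
  subspace_closed : closed subspace_set ;
  subspace0 : subspace_set 0 ;
  subspaceP : forall (a : R[i]) (x y : H),
    subspace_set x -> subspace_set y -> subspace_set (a *: x + y)
}.

Section SubHilbert.
Variables (R : realType) (H : hilbertType R) (V : closedSubspace H).

Record subHilbert : Type :=
  SubHilbert { sub_incl : H ; sub_inclP : sub_incl \in subspace_set V }.

HB.instance Definition _ := [isSub of subHilbert for sub_incl].
HB.instance Definition _ := [Choice of subHilbert by <:].

Definition subspace_pred : {pred H} := [pred x | x \in subspace_set V].

Lemma subspace_submod_closed : submod_closed subspace_pred.
Proof.
split; first exact/mem_set/subspace0.
by move=> a x y /set_mem Vx /set_mem Vy; exact/mem_set/subspaceP.
Qed.

HB.instance Definition _ :=
  GRing.isSubmodClosed.Build R[i] H subspace_pred subspace_submod_closed.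
HB.instance Definition _ :=
  GRing.SubChoice_isSubZmodule.Build H subspace_pred subHilbert
    (GRing.zmodClosedP subspace_pred).
HB.instance Definition _ :=
  GRing.SubZmodule_isSubLmodule.Build R[i] H subspace_pred subHilbert
    (GRing.subsemimodClosedP subspace_pred).

Lemma sub_inclD : {morph sub_incl : x y / x + y}. Proof. by []. Qed.
Lemma sub_inclB : {morph sub_incl : x y / x - y}. Proof. by []. Qed.
Lemma sub_inclZ (a : R[i]) : {morph sub_incl : x / a *: x}. Proof. by []. Qed.
Lemma sub_incl_inj : injective sub_incl. Proof. exact: val_inj. Qed.

Definition sub_norm (x : subHilbert) : R[i] := `|sub_incl x|.

Let ler_normD x y : sub_norm (x + y) <= sub_norm x + sub_norm y.
Proof. by rewrite /sub_norm sub_inclD ler_normD. Qed.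

Let normrZ (a : R[i]) x : sub_norm (a *: x) = `|a| * sub_norm x.
Proof. by rewrite /sub_norm sub_inclZ normrZ. Qed.

Let normr0_eq0 x : sub_norm x = 0 -> x = 0.
Proof. by move=> /normr0_eq0 x0; exact: sub_incl_inj. Qed.

HB.instance Definition _ :=
  Lmodule_isNormed.Build R[i] subHilbert ler_normD normrZ normr0_eq0.

Lemma norm_incl (x : subHilbert) : `|sub_incl x| = `|x|.
Proof. by []. Qed.

Let complete (F : set_system subHilbert) :
  ProperFilter F -> cauchy F -> cvg F.
Proof.
move=> FF /cauchy_ballP F_cauchy.
have G_cvg : cvg (sub_incl @ F).
  apply: cauchy_cvg; apply/cauchy_ballP => e e0.
  have [[A B]/= [FA FB] AB] := F_cauchy _ e0.
  exists (sub_incl @` A, sub_incl @` B); first split.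
  - by apply: filterS FA => x Ax; exists x.
  - by apply: filterS FB => x Bx; exists x.
  move=> [_ _]/= [[x Ax <-] [y By <-]].
  have := AB (x, y) (conj Ax By).
  by rewrite -!ball_normE /= -sub_inclB norm_incl.
have Vl : subspace_set V (lim (sub_incl @ F)).
  apply: (@closed_cvg _ _ _ _ sub_incl (subspace_set V)) G_cvg => //.
    exact: subspace_closed.
  by apply: filterE => x; exact/set_mem/sub_inclP.
apply/cvg_ex; exists (SubHilbert (mem_set Vl)).
apply/cvgrPdist_lt => e e0.
by move/cvgrPdist_lt : G_cvg => /(_ _ e0).
Qed.

HB.instance Definition _ := Uniform_isComplete.Build subHilbert complete.

Definition sub_dot (x y : subHilbert) : R[i] := dotp (sub_incl x) (sub_incl y).

Let dot_bilinear :
  bilinear_for *%R (@Num.conj R[i] \; *%R) sub_dot.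
Proof.
by split=> x a y z; rewrite /sub_dot sub_inclD sub_inclZ ?linearPl ?linearPr.
Qed.

HB.instance Definition _ := @bilinear_isBilinear.Build R[i] subHilbert
  subHilbert R[i] *%R (@Num.conj R[i] \; *%R) sub_dot dot_bilinear.

Let dot_hermitian x y : sub_dot x y = (-1) ^+ false * Num.conj (sub_dot y x).
Proof. exact: hermitian_subproof. Qed.

HB.instance Definition _ := @isHermitianSesquilinear.Build R[i] subHilbert
  false (@Num.conj R[i]) sub_dot dot_hermitian.

Let dot_gt0 x : x != 0 -> 0 < sub_dot x x.
Proof.
move=> x0; apply: neq0_dnorm_gt0; apply: contra x0 => /eqP x0.
exact/eqP/sub_incl_inj.
Qed.

HB.instance Definition _ := @isDotProduct.Build R[i] subHilbert sub_dot dot_gt0.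

Let normr_dot x : `|x| ^+ 2 = sub_dot x x.
Proof. exact: normr_dotp. Qed.

HB.instance Definition _ :=
  CompleteNormedModule_isHilbert.Build R subHilbert normr_dot.

Lemma dotp_incl (x y : subHilbert) : dotp (sub_incl x) (sub_incl y) = dotp x y.
Proof. by []. Qed.

End SubHilbert.

Coercion subHilbert : closedSubspace >-> Sortclass.

Definition bounded_op (R : realType) (H K : hilbertType R) (A : H -> K) :=
  linear A /\ exists M : R[i], forall x, `|A x| <= M * `|x|.

Section Operators.
Variables (R : realType) (H K : hilbertType R).
Implicit Type A : H -> K.

(* The Hilbert adjoint: the unique B below, which exists when A is bounded. *)
Definition adj A : K -> H :=
  get [set B : K -> H |
    bounded_op B /\ forall x y, dotp (A x) y = dotp x (B y)].

Definition unitary A :=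
  [/\ bounded_op A, adj A \o A = idfun & A \o adj A = idfun].

Definition ker A : set H := A @^-1` [set 0].

End Operators.

Section Endomorphisms.
Variables (R : realType) (H : hilbertType R).
Implicit Types (A P Q U : H -> H).

Definition orthogonal_projection P :=
  [/\ bounded_op P, adj P = P & P \o P = P].

(* In the order of R[i], 0 <= z means that z is real and nonnegative. *)
Definition positive_op A := bounded_op A /\ forall x, 0 <= dotp (A x) x.

Definition contraction_op A := forall x, `|A x| <= `|x|.

Definition op_eigenvalue A (a : R[i]) := exists2 v, v != 0 & A v = a *: v.

(* The positive square root: the unique S below, which exists when A is
   positive. *)
Definition sqrt_op A : H -> H :=
  get [set S : H -> H | positive_op S /\ S \o S = A].

Definition generic_position P Q :=
  [/\ range P `&` range Q = [set 0], range P `&` ker Q = [set 0],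
      ker P `&` range Q = [set 0] & ker P `&` ker Q = [set 0]].

Definition outU Q P : set (H -> H) := [set U | unitary U /\ U \o P = Q \o U].

Definition intU Q P : set (H -> H) :=
  [set U | [/\ unitary U, U \o P = Q \o U & P \o U = U \o Q]].

(* The operator on V (+) W with matrix [[A11, A12], [A21, A22]]: the adjoint of
   the inclusion of a closed subspace is the orthogonal projection onto it. *)
Definition opmx (V W : closedSubspace H) (A11 : V -> V) (A12 : W -> V)
    (A21 : V -> W) (A22 : W -> W) : H -> H := fun z =>
  let x := adj (@sub_incl R H V) z in let y := adj (@sub_incl R H W) z in
  sub_incl (A11 x + A12 y) + sub_incl (A21 x + A22 y).

End Endomorphisms.

Arguments opmx {R H} V W A11 A12 A21 A22 z.

(* Main.v *)
From mathcomp Require Import sesquilinear.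
Require Import Defs.
From mathcomp Require Import all_boot all_order all_algebra complex.
From mathcomp Require Import all_classical all_reals all_analysis.
From mathcomp Require Import ring.

(** The operator [M] of the theorem is a symmetry, that is, a unitary involution,
and it satisfies [M P = Q M]. With [S] and [C] the square roots of [Q0] and
[1 - Q0], this is the algebra of a reflection matrix
[[cos t, sin t], [sin t, - cos t]] with commuting self-adjoint entries:
the computation only needs [S^2 + C^2 = 1] and [S C = C S]. Hence [U]
intertwines [P] with [Q] from the outside iff the unitary [M U] commutes with
[P], which means that [M U] is block diagonal with unitary blocks: this is part
(a) ([outU_symmetry]).

For part (b), [M P = Q M] and [M^2 = 1] show that [U = M V] also satisfies
[P U = U Q] iff [V] commutes with [Q] ([diag_commute_Q]). For
[V = diag (U0, S0)] the diagonal corner gives [U0 Q0 = Q0 U0] and the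
off-diagonal one gives [U0 S C D = S C D S0]. An operator commuting with
[Q0 = S^2] commutes with [S], and likewise with [C]; as [S C] is injective,
because neither 0 nor 1 is an eigenvalue of [Q0], this leaves [U0 D = D S0],
so [S0 = D^* U0 D].

That commutation with [S^2] implies commutation with [S] is usually read off a
functional calculus. Here it comes from a growth estimate: the commutator [Y]
anticommutes with [S], so [(1 + S)^n Y v = Y (1 - S)^n v] stays bounded in [n]
because [0 <= S <= 1], whereas the left-hand side grows unless [S Y v = 0]
([anticommuting_op], [commute_sqrt]).

Adjoints and square roots are picked by a choice operator, so their existence
has to be justified each time they are used. Whenever the object sought does not
exist, the chosen value is a constant function, and the hypotheses exclude it or
make the space trivial: a unitary has a left inverse in its adjoint, an
orthogonal projection equals its adjoint, and a constant [S C] would make [Q]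
block diagonal with corner [Q0], so [Q0^2 = Q0], which without the eigenvalues
0 and 1 is possible only on the zero space. Finally [S C = C S] holds because [Q] is
self-adjoint, the two sides being its off-diagonal corners up to [D]. *)

Set Implicit Arguments.
Unset Strict Implicit.

Import Order.TTheory GRing.Theory Num.Theory.

Local Open Scope classical_set_scope.
Local Open Scope ring_scope.

(** * Linear maps and inner products *)

Section LinearMaps.
Variables (F : nzRingType) (V W : lmodType F) (A : V -> W).
Hypothesis linA : linear A.

Lemma linear_mapB x y : A (x - y) = A x - A y.
Proof. exact: zmod_morphism_linear linA x y. Qed.

Lemma linear_map0 : A 0 = 0.
Proof. by rewrite -(subrr 0) linear_mapB subrr. Qed.

Lemma linear_mapN x : A (- x) = - A x.
Proof. by rewrite -sub0r linear_mapB linear_map0 sub0r. Qed.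

Lemma linear_mapD x y : A (x + y) = A x + A y.
Proof. by rewrite -{1}[y]opprK linear_mapB linear_mapN opprK. Qed.

Lemma linear_mapZ a x : A (a *: x) = a *: A x.
Proof. exact: scalable_linear linA a x. Qed.

End LinearMaps.

Section LinearOperations.
Variables (F : comNzRingType) (U V W : lmodType F).

Lemma linear_map_zero : linear (0 : V -> W).
Proof. by move=> a x y; rewrite [LHS](_ : _ = 0)// scaler0 addr0. Qed.

Lemma linear_map_comp (A : V -> W) (B : U -> V) :
  linear A -> linear B -> linear (A \o B).
Proof. by move=> linA linB a x y /=; rewrite linB linA. Qed.

Lemma linear_map_opp (A : V -> W) : linear A -> linear (- A).
Proof.
move=> linA a x y.
by rewrite [LHS](_ : _ = - A (a *: x + y))// linA opprD -scalerN.
Qed.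

End LinearOperations.

Section InnerProduct.
Variables (R : realType) (H : hilbertType R).
Implicit Types x y z : H.

Lemma dotC x y : dotp x y = Num.conj (dotp y x).
Proof. by rewrite hermC expr0 mul1r. Qed.

Lemma dotDl x y z : dotp (x + y) z = dotp x z + dotp y z.
Proof. exact: linearDl. Qed.
Lemma dotDr x y z : dotp x (y + z) = dotp x y + dotp x z.
Proof. exact: linearDr. Qed.
Lemma dotNl x y : dotp (- x) y = - dotp x y.
Proof. exact: linearNl. Qed.
Lemma dotNr x y : dotp x (- y) = - dotp x y.
Proof. exact: linearNr. Qed.
Lemma dotZl a x y : dotp (a *: x) y = a * dotp x y.
Proof. exact: linearZl_LR. Qed.
Lemma dotZr a x y : dotp x (a *: y) = Num.conj a * dotp x y.
Proof. exact: linearZr_LR. Qed.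
Lemma dot0r x : dotp x 0 = 0.
Proof. exact: linear0r. Qed.

Lemma dotp_inj x y : (forall z, dotp z x = dotp z y) -> x = y.
Proof.
move=> xy; apply/eqP; rewrite -subr_eq0 -(dnorm_eq0 (@dotp R H)).
by rewrite dotDr dotNr xy subrr.
Qed.

Lemma dotp_ge0 x : 0 <= dotp x x.
Proof. exact: dnorm_ge0. Qed.

Lemma dotp_eq0 x : dotp x x = 0 -> x = 0.
Proof. by move=> /eqP; rewrite (dnorm_eq0 (@dotp R H)) => /eqP. Qed.

Lemma ler_norm_dotp (K : hilbertType R) x (y : K) :
  (`|x| <= `|y|) = (dotp x x <= dotp y y).
Proof. by rewrite -!normr_dotp ler_pXn2r // ?nnegrE. Qed.

End InnerProduct.

(** * Adjoints and unitaries *)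

Definition symmetric_op (R : realType) (H : hilbertType R) (A : H -> H) :=
  forall x y, dotp (A x) y = dotp x (A y).

Section Adjoint.
Variables (R : realType) (H K : hilbertType R).

Lemma adjE (A : H -> K) (B : K -> H) :
  bounded_op B -> (forall x y, dotp (A x) y = dotp x (B y)) -> adj A = B.
Proof.
move=> bB AB; apply: get_unique => // C [_ AC].
by apply/funext => y; apply: dotp_inj => x; rewrite -AB -AC.
Qed.

(** The second case is that of an operator without adjoint, for which the choice
operator returns its default value. *)
Lemma adj_cases (A : H -> K) :
  (bounded_op (adj A) /\ forall x y, dotp (A x) y = dotp x (adj A y)) \/
  exists c, forall y, adj A y = c.
Proof.
have [[B AB]|noB] := pselect (exists B, bounded_op B /\
    forall x y, dotp (A x) y = dotp x (B y)).
  left; exact: (getI (P := [set B : K -> H |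
    bounded_op B /\ forall x y, dotp (A x) y = dotp x (B y)])) AB.
right; exists point => y; rewrite /adj getPN // => B AB.
by apply: noB; exists B.
Qed.

(** The bound can be negative only on the zero space, where 0 also serves. *)
Lemma bounded_op_ge0 (A : H -> K) : bounded_op A ->
  exists2 M : R[i], 0 <= M & forall x, `|A x| <= M * `|x|.
Proof.
move=> [linA [M AM]]; have [[x x0]|H0] := pselect (exists x : H, x != 0).
  exists M => //; rewrite -(@pmulr_lge0 _ `|x|) ?normr_gt0//.
  exact: le_trans (normr_ge0 _) (AM x).
exists 0 => // x; have [->|x0] := eqVneq x 0.
  by rewrite (linear_map0 linA) !normr0 mulr0.
by case: H0; exists x.
Qed.

Lemma isometry_bounded (A : H -> K) :
  linear A -> (forall x, dotp (A x) (A x) = dotp x x) -> bounded_op A.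
Proof.
move=> linA isoA; split=> //; exists 1 => x.
by rewrite mul1r ler_norm_dotp isoA.
Qed.

End Adjoint.

Section Unitary.
Variables (R : realType) (H K : hilbertType R).

(** A constant function is injective only on the zero space, where every identity
holds; otherwise the cancellation laws force [adj A] to be the true adjoint. *)
Lemma unitary_adj (A : H -> K) : unitary A ->
  [/\ linear A, linear (adj A), cancel A (adj A), cancel (adj A) A &
      forall x y, dotp (A x) y = dotp x (adj A y)].
Proof.
move=> [[linA _] /funeqP AK /funeqP KA].
have {}AK : cancel A (adj A) by exact: AK.
have {}KA : cancel (adj A) A by exact: KA.
have [[[linA' _] dotA]|[c adjAc]] := adj_cases A; first by split.
have H0 (x : H) : x = 0 by rewrite -[x]AK -[0]AK !adjAc.
split=> // [a x y|x y]; first by rewrite [LHS]H0 [RHS]H0.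
by rewrite [x]H0 [adj A y]H0 (linear_map0 linA) dot0r dotC dot0r rmorph0.
Qed.

Lemma unitaryP (A : H -> K) (B : K -> H) : linear A -> linear B ->
  cancel A B -> cancel B A -> (forall x y, dotp (A x) y = dotp x (B y)) ->
  unitary A.
Proof.
move=> linA linB AK BK dotA.
have bA : bounded_op A by apply: isometry_bounded => // x; rewrite dotA AK.
have bB : bounded_op B.
  by apply: isometry_bounded => // x; rewrite -dotA BK.
have adjA : adj A = B by exact: adjE.
by split=> //; rewrite adjA; apply/funext.
Qed.

End Unitary.

Lemma unitary_comp (R : realType) (X Y Z : hilbertType R)
    (A : Y -> Z) (B : X -> Y) :
  unitary A -> unitary B -> unitary (A \o B).
Proof.
move=> /unitary_adj[linA linA' AK KA dotA] /unitary_adj[linB linB' BK KB dotB].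
apply: (@unitaryP _ _ _ _ (adj B \o adj A)).
- exact: (linear_map_comp linA linB).
- exact: (linear_map_comp linB' linA').
- exact: can_comp AK BK.
- exact: can_comp KB KA.
- by move=> x y; rewrite /= dotA dotB.
Qed.

(** * Symmetric and positive operators *)

Section SymmetricOperators.
Variables (R : realType) (H : hilbertType R).
Implicit Types A : H -> H.

(** If [A] had no adjoint then [A = adj A] would be constant, hence zero by
linearity, and zero is symmetric. *)
Lemma selfadjoint_symmetric A : linear A -> adj A = A -> symmetric_op A.
Proof.
move=> linA adjA; have [[_ dotA]|[c]] := adj_cases A.
  by move=> x y; rewrite dotA adjA.
rewrite adjA => Ac.
have A0 x : A x = 0 by rewrite Ac -(Ac 0) (linear_map0 linA).
by move=> x y; rewrite !A0 dot0r dotC dot0r rmorph0.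
Qed.

(** Polarization: the form of [A] is real at [x + y] and at [x + i y]. *)
Lemma positive_symmetric A : positive_op A -> symmetric_op A.
Proof.
move=> [[linA _] posA] x y.
have realA u : dotp u (A u) = dotp (A u) u.
  by rewrite dotC; apply/CrealP; exact: ger0_real (posA u).
have eq1 := realA (x + y); have eqi := realA (x + 'i *: y).
move: eq1 eqi; rewrite !(linear_mapD linA, linear_mapZ linA).
rewrite !(dotDl, dotDr, dotZl, dotZr) !realA conjCi.
set a := dotp (A x) y; set b := dotp x (A y).
set c := dotp (A y) x; set d := dotp y (A x).
set p := dotp (A x) x; set q := dotp (A y) y => e1 e2.
(* [c] and [d] are conjugate to [b] and [a]; [e1] and [e2] read
   [b + d = c + a] and [d - b = c - a], and together they give [a = b]. *)
have e3 : 'i * (d - b - (c - a)) = 0 :> R[i].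
  by move/eqP: e2; rewrite -subr_eq0 => /eqP <-; ring.
move/eqP: e3; rewrite mulf_eq0 (negPf (neq0Ci _)) => /eqP e3.
move/eqP: e1; rewrite -subr_eq0 => /eqP e1.
have : 2 * (a - b) = 0 by rewrite -(subrr 0) -{1}e3 -e1; ring.
by move/eqP; rewrite mulf_eq0 pnatr_eq0 subr_eq0 => /eqP.
Qed.

Lemma sum_squares_contraction A B : symmetric_op A -> symmetric_op B ->
  (forall x, A (A x) + B (B x) = x) -> contraction_op A.
Proof.
move=> symA symB AB x; rewrite ler_norm_dotp.
have -> : dotp x x = dotp (A x) (A x) + dotp (B x) (B x).
  by rewrite -{1}[x]AB dotDl symA symB.
by rewrite lerDl dotp_ge0.
Qed.

End SymmetricOperators.

Lemma complex_archi (R : realType) (z c : R[i]) : 0 <= z ->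
  (forall n, z *+ n <= c) -> z = 0.
Proof.
case: z c => a b [c d]; rewrite lecE /= => /andP[/eqP -> a0] zc.
have ac n : a *+ n <= c.
  have := zc n; rewrite lecE => /andP[_] /=.
  by rewrite raddfMn.
have [->//|an0] := eqVneq a 0.
have a1 : 0 < a by rewrite lt_neqAle eq_sym an0.
have c0 : 0 <= c := le_trans (mulrn_wge0 0 a0) (ac 0%N).
have := archi_boundP (divr_ge0 c0 a0); rewrite ltr_pdivrMr// mulr_natl.
by move=> /lt_le_trans /(_ (ac _)); rewrite ltxx.
Qed.

(** * Commuting with the square root of an operator *)

Section SquareRootCommutation.
Variables (R : realType) (H : hilbertType R) (S : H -> H).
Hypotheses (posS : positive_op S) (contrS : contraction_op S).

Let linS : linear S. Proof. by case: posS => [[]]. Qed.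
Let symS : symmetric_op S. Proof. exact: positive_symmetric. Qed.

Let dotS_ge0 x : 0 <= dotp (S x) x. Proof. by case: posS. Qed.

Let dotp_contr x : dotp (S x) (S x) <= dotp x x.
Proof. by rewrite -ler_norm_dotp. Qed.

Let dotS_le x : dotp (S x) x <= dotp x x.
Proof.
have := dotp_ge0 (x - S x).
rewrite !(dotDl, dotDr, dotNl, dotNr) -(symS x x) => ge0.
rewrite -(ler_pMn2r (ltn0Sn 1)) -subr_ge0.
apply: (le_trans ge0); rewrite -subr_ge0.
have := dotp_contr x; rewrite -subr_ge0.
by congr (0 <= _); ring.
Qed.

(** The operator inequality [S^2 <= S], from
[S - S^2 = S (1 - S) S + (1 - S) S (1 - S)]. *)
Let dotSS_le x : dotp (S x) (S x) <= dotp (S x) x.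
Proof.
have Sdot : dotp (S (S x)) x = dotp (S x) (S x) by rewrite symS.
have -> : dotp (S x) (S x) = dotp (S x) x -
    (dotp (S x) (S x) - dotp (S (S x)) (S x) + dotp (S (x - S x)) (x - S x)).
  by rewrite (linear_mapB linS) !(dotDl, dotDr, dotNl, dotNr) Sdot; ring.
by rewrite gerBl addr_ge0// subr_ge0.
Qed.

Let shrink x : dotp (x - S x) (x - S x) <= dotp x x.
Proof.
have h1 := dotS_ge0 x; have h2 := dotSS_le x.
rewrite !(dotDl, dotDr, dotNl, dotNr) -(symS x x) -subr_ge0.
by rewrite -subr_ge0 in h2; have := addr_ge0 h1 h2; congr (0 <= _); ring.
Qed.

Let grow x : dotp x x + dotp (S x) (S x) <= dotp (x + S x) (x + S x).
Proof.
rewrite !(dotDl, dotDr) -(symS x x).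
by rewrite -!addrA lerD2l addrA lerDr addr_ge0.
Qed.

(** [(1 + S)^n w] has squared norm at least [n * |S w|^2], whereas for [w = Y v]
it equals [Y (1 - S)^n v], which is bounded in [n]. *)
Lemma anticommuting_op (Y : H -> H) : bounded_op Y ->
  (forall x, S (Y x) = - Y (S x)) -> forall x, S (Y x) = 0.
Proof.
move=> bY SY v; have linY := bY.1; have [K K0 YK] := bounded_op_ge0 bY.
pose f x := x + S x; pose g x := x - S x.
have iterY n : iter n f (Y v) = Y (iter n g v).
  by elim: n => //= n ->; rewrite /f SY (linear_mapB linY).
have iterS n x : iter n f (S x) = S (iter n f x).
  by elim: n => //= n ->; rewrite /f (linear_mapD linS).
have iter_grow n x : dotp x x <= dotp (iter n f x) (iter n f x).
  elim: n => //= n IHn; apply: (le_trans IHn).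
  by apply: le_trans (grow _); rewrite lerDl dotp_ge0.
have iter_shrink n x : dotp (iter n g x) (iter n g x) <= dotp x x.
  by elim: n => //= n IHn; apply: le_trans (shrink _) IHn.
have lower n : dotp (S (Y v)) (S (Y v)) *+ n <=
    dotp (iter n f (Y v)) (iter n f (Y v)).
  elim: n => [|n IHn]; first by rewrite mulr0n dotp_ge0.
  rewrite mulrS addrC; apply: le_trans (grow _).
  by rewrite -iterS lerD.
have upper n : dotp (iter n f (Y v)) (iter n f (Y v)) <= K ^+ 2 * dotp v v.
  rewrite iterY.
  apply: (le_trans (_ : _ <= K ^+ 2 * dotp (iter n g v) (iter n g v))).
    by rewrite -!normr_dotp -exprMn lerXn2r ?nnegrE ?mulr_ge0.
  by rewrite ler_wpM2l// exprn_ge0.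
apply: dotp_eq0; apply: (complex_archi (dotp_ge0 _)) => n.
exact: le_trans (lower n) (upper n).
Qed.

(** The commutator of [T] and [S] anticommutes with [S] because [T] commutes with
[S^2]. *)
Lemma commute_sqrt (T : H -> H) :
  bounded_op T -> (forall x, S x = 0 -> x = 0) ->
  (forall x, T (S (S x)) = S (S (T x))) -> forall x, T (S x) = S (T x).
Proof.
move=> bT injS TSS x; have linT := bT.1.
have [M M0 TM] := bounded_op_ge0 bT.
pose Y x := T (S x) - S (T x).
have bY : bounded_op Y.
  split=> [a u v|].
    by rewrite /Y linS !linT linS opprD addrACA -scalerBr.
  exists (M + M) => u; rewrite mulrDl; apply: (le_trans (ler_normB _ _)).
  rewrite lerD//; first by apply: (le_trans (TM _)); rewrite ler_wpM2l.
  exact: le_trans (contrS _) (TM _).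
have SY u : S (Y u) = - Y (S u).
  by rewrite /Y (linear_mapB linS) TSS opprB.
by apply/eqP; rewrite -subr_eq0; apply/eqP/injS/(anticommuting_op bY).
Qed.

End SquareRootCommutation.

(** As for adjoints, the second case is the default value of the choice
operator. *)
Lemma sqrt_op_cases (R : realType) (H : hilbertType R) (A : H -> H) :
  (positive_op (sqrt_op A) /\ sqrt_op A \o sqrt_op A = A) \/
  (~ exists S, positive_op S /\ S \o S = A) /\
  exists c, forall x, sqrt_op A x = c.
Proof.
have [[S SA]|noS] := pselect (exists S, positive_op S /\ S \o S = A).
  left; exact: (getI (P := [set S : H -> H | positive_op S /\ S \o S = A])) SA.
right; split=> //; exists point => x; rewrite /sqrt_op getPN // => S SA.
by apply: noS; exists S.
Qed.

(** * Block operators for the decomposition defined by a projection *)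

Section Decomposition.
Variables (R : realType) (H : hilbertType R).

(** The adjoint of an inclusion is the projection onto the subspace, here any [T]
with the properties of that projection. *)
Lemma adj_sub_incl (X : closedSubspace H) (T : H -> H) : bounded_op T ->
  symmetric_op T -> (forall z, subspace_set X (T z)) ->
  (forall x : X, T (sub_incl x) = sub_incl x) ->
  forall z, sub_incl (adj (@sub_incl R H X) z) = T z.
Proof.
move=> [linT [M TM]] symT XT TX z.
rewrite (@adjE _ _ _ _ (fun z => SubHilbert (mem_set (XT z))))//.
  split; last by exists M.
  by move=> a x y; apply: sub_incl_inj; rewrite /= linT.
by move=> x y; rewrite -[RHS]dotp_incl /= -symT TX.
Qed.

(** Invariance under the adjoint makes the restriction surjective. *)
Lemma unitary_restrict (X : closedSubspace H) (U : H -> H) : unitary U ->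
  (forall x : X, subspace_set X (U (sub_incl x))) ->
  (forall x : X, subspace_set X (adj U (sub_incl x))) ->
  exists2 U0 : X -> X, unitary U0 & forall x, sub_incl (U0 x) = U (sub_incl x).
Proof.
move=> /unitary_adj[linU linU' UK KU dotU] XU XU'.
pose U0 (x : X) : X := SubHilbert (mem_set (XU x)).
pose U0' (x : X) : X := SubHilbert (mem_set (XU' x)).
exists U0 => //; apply: (@unitaryP _ _ _ U0 U0').
- by move=> a x y; apply: sub_incl_inj; rewrite /= linU.
- by move=> a x y; apply: sub_incl_inj; rewrite /= linU'.
- by move=> x; apply: sub_incl_inj; rewrite /= UK.
- by move=> x; apply: sub_incl_inj; rewrite /= KU.
- by move=> x y; rewrite -[LHS]dotp_incl /= dotU.
Qed.

Variables (P : H -> H) (V W : closedSubspace H).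
Hypothesis projP : orthogonal_projection P.
Hypothesis rangeP : subspace_set V = range P.
Hypothesis kerP : subspace_set W = ker P.

Let linP : linear P. Proof. by case: projP => [[]]. Qed.
Let symP : symmetric_op P.
Proof. by case: projP => _ adjP _; exact: selfadjoint_symmetric. Qed.
Let PP z : P (P z) = P z.
Proof. by case: projP => _ _ /funeqP /(_ z). Qed.

Lemma proj_incl_range (x : V) : P (sub_incl x) = sub_incl x.
Proof.
have /set_mem := sub_inclP x; rewrite rangeP => -[z _ <-]; exact: PP.
Qed.

Lemma proj_incl_ker (y : W) : P (sub_incl y) = 0.
Proof. by have /set_mem := sub_inclP y; rewrite kerP. Qed.

Definition blk (x : V) (y : W) : H := sub_incl x + sub_incl y.

Lemma blk0 : blk 0 0 = 0.
Proof. exact: addr0. Qed.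

Lemma proj_blk x y : P (blk x y) = blk x 0.
Proof.
by rewrite (linear_mapD linP) proj_incl_range proj_incl_ker /blk !addr0.
Qed.

Lemma adj_incl_range z : sub_incl (adj (@sub_incl R H V) z) = P z.
Proof.
apply: adj_sub_incl => //; [by case: projP| |exact: proj_incl_range].
by move=> {}z; rewrite rangeP; exists z.
Qed.

Lemma adj_incl_ker z : sub_incl (adj (@sub_incl R H W) z) = z - P z.
Proof.
apply: (@adj_sub_incl W (fun z => z - P z)).
- split=> [a x y|].
    by rewrite linP scalerBr opprD addrACA.
  have bP : bounded_op P by case: projP.
  have [M _ PM] := bounded_op_ge0 bP.
  exists (1 + M) => x; rewrite mulrDl mul1r.
  by apply: (le_trans (ler_normB _ _)); rewrite lerD2l.
- by move=> x y; rewrite dotDl dotNl symP dotDr dotNr.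
- by move=> x; rewrite kerP /ker /= (linear_mapB linP) PP subrr.
- by move=> y; rewrite proj_incl_ker subr0.
Qed.

Lemma adj_incl_blk x y :
  adj (@sub_incl R H V) (blk x y) = x /\ adj (@sub_incl R H W) (blk x y) = y.
Proof.
split; apply: sub_incl_inj; rewrite ?adj_incl_range ?adj_incl_ker proj_blk.
  by rewrite /blk addr0.
by rewrite /blk addr0 addrAC subrr add0r.
Qed.

Lemma blk_ind (T : H -> Prop) : (forall x y, T (blk x y)) -> forall z, T z.
Proof.
move=> Tblk z; rewrite -[z](subrKC (P z)) -adj_incl_ker -adj_incl_range.
exact: Tblk.
Qed.

Lemma blk_inj x y x' y' : blk x y = blk x' y' -> x = x' /\ y = y'.
Proof.
move=> e; have [ex ey] := adj_incl_blk x y.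
by have [] := adj_incl_blk x' y'; rewrite -e ex ey.
Qed.

Lemma dotp_blk x y x' y' :
  dotp (blk x y) (blk x' y') = dotp x x' + dotp y y'.
Proof.
have VW (a : V) (b : W) : dotp (sub_incl a) (sub_incl b) = 0.
  by rewrite -proj_incl_range symP proj_incl_ker dot0r.
have WV (a : V) (b : W) : dotp (sub_incl b) (sub_incl a) = 0.
  by rewrite dotC VW rmorph0.
by rewrite /blk !(dotDl, dotDr) VW WV addr0 add0r !dotp_incl.
Qed.

Lemma blk_lin a x y x' y' :
  a *: blk x y + blk x' y' = blk (a *: x + x') (a *: y + y').
Proof. by rewrite /blk scalerDr addrACA. Qed.

Lemma opmx_blk A11 A12 A21 A22 x y :
  opmx V W A11 A12 A21 A22 (blk x y) = blk (A11 x + A12 y) (A21 x + A22 y).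
Proof. by rewrite /opmx; have [-> ->] := adj_incl_blk x y. Qed.

Lemma blk_ext (A B : H -> H) :
  (forall x y, A (blk x y) = B (blk x y)) -> A = B.
Proof. by move=> AB; apply/funext; apply: blk_ind. Qed.

Lemma opmx_linear A11 A12 A21 A22 : linear A11 -> linear A12 ->
  linear A21 -> linear A22 -> linear (opmx V W A11 A12 A21 A22).
Proof.
move=> l11 l12 l21 l22 a z z'; elim/blk_ind: z => x y; elim/blk_ind: z' => x' y'.
rewrite blk_lin !opmx_blk blk_lin l11 l12 l21 l22; congr blk;
by rewrite scalerDr addrACA.
Qed.

Lemma opmx_diag_unitary (U0 : V -> V) (S0 : W -> W) :
  unitary U0 -> unitary S0 -> unitary (opmx V W U0 0 0 S0).
Proof.
move=> /unitary_adj[linU linU' UK KU dotU] /unitary_adj[linS linS' SK KS dotS].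
apply: (@unitaryP _ _ _ _ (opmx V W (adj U0) 0 0 (adj S0))).
- by apply: opmx_linear => //; exact: linear_map_zero.
- by apply: opmx_linear => //; exact: linear_map_zero.
- by move=> z; elim/blk_ind: z => x y; rewrite !opmx_blk !addr0 !add0r UK SK.
- by move=> z; elim/blk_ind: z => x y; rewrite !opmx_blk !addr0 !add0r KU KS.
- move=> z z'; elim/blk_ind: z => x y; elim/blk_ind: z' => x' y'.
  by rewrite !opmx_blk !dotp_blk !addr0 !add0r dotU dotS.
Qed.

Lemma opmx_diag_commute (U0 : V -> V) (S0 : W -> W) :
  linear U0 -> linear S0 ->
  opmx V W U0 0 0 S0 \o P = P \o opmx V W U0 0 0 S0.
Proof.
move=> linU linS; apply: blk_ext => x y /=.
rewrite opmx_blk !proj_blk opmx_blk (linear_map0 linS).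
by rewrite !addr0.
Qed.

Lemma unitary_commute_diag (U : H -> H) : unitary U -> U \o P = P \o U ->
  exists U0 S0, [/\ unitary U0, unitary S0 & U = opmx V W U0 0 0 S0].
Proof.
move=> uU /funeqP UP.
have [linU linU' UK KU dotU] := unitary_adj uU.
have {}UP z : U (P z) = P (U z) by exact: UP.
have UP' z : adj U (P z) = P (adj U z) by rewrite -{1}[z]KU -UP UK.
have [|x|U0 uU0 U0E] := @unitary_restrict V U uU.
- by move=> x; rewrite rangeP -proj_incl_range UP; eexists.
- by rewrite rangeP -proj_incl_range UP'; eexists.
have [|y|S0 uS0 S0E] := @unitary_restrict W U uU.
- by move=> y; rewrite kerP /ker /= -UP proj_incl_ker (linear_map0 linU).
- by rewrite kerP /ker /= -UP' proj_incl_ker (linear_map0 linU').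
exists U0, S0; split=> //; apply: blk_ext => x y.
by rewrite opmx_blk addr0 add0r /blk U0E S0E (linear_mapD linU).
Qed.

(** * The symmetry exchanging the two projections *)

Section SymmetryMatrix.
Variables (S C : V -> V) (D : W -> V) (Q : H -> H).
Hypotheses (posS : positive_op S) (posC : positive_op C).
Hypothesis sumSC : forall x, S (S x) + C (C x) = x.
Hypothesis commSC : forall x, S (C x) = C (S x).
Hypothesis injS : forall x, S x = 0 -> x = 0.
Hypothesis injC : forall x, C x = 0 -> x = 0.
Hypothesis unitaryD : unitary D.
Hypothesis QE : Q = opmx V W (S \o S) (S \o C \o D)
  (adj D \o S \o C) (adj D \o (C \o C) \o D).

Let M := opmx V W S (C \o D) (adj D \o C) (- (adj D \o S \o D)).

Let linS : linear S. Proof. by case: posS => [[]]. Qed.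
Let linC : linear C. Proof. by case: posC => [[]]. Qed.
Let linD : linear D. Proof. by case/unitary_adj: unitaryD. Qed.
Let linD' : linear (adj D). Proof. by case/unitary_adj: unitaryD. Qed.
Let DK : cancel D (adj D). Proof. by case/unitary_adj: unitaryD. Qed.
Let KD : cancel (adj D) D. Proof. by case/unitary_adj: unitaryD. Qed.
Let dotD x y : dotp (D x) y = dotp x (adj D y).
Proof. by case/unitary_adj: unitaryD. Qed.
Let dotD' x y : dotp (adj D x) y = dotp x (D y).
Proof. by rewrite dotC -dotD -dotC. Qed.
Let symS : symmetric_op S. Proof. exact: positive_symmetric. Qed.
Let symC : symmetric_op C. Proof. exact: positive_symmetric. Qed.

Let M_blk x y : M (blk x y) = blk (S x + C (D y)) (adj D (C x - S (D y))).
Proof. by rewrite /M opmx_blk /= (linear_mapB linD'). Qed.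

Let Q_blk x y : Q (blk x y) =
  blk (S (S x + C (D y))) (adj D (C (S x + C (D y)))).
Proof.
rewrite QE opmx_blk /= (linear_mapD linS) (linear_mapD linC).
by rewrite (linear_mapD linD') !commSC.
Qed.

Let linM : linear M.
Proof.
apply: opmx_linear => //.
- exact: (linear_map_comp linC linD).
- exact: (linear_map_comp linD' linC).
- exact: (linear_map_opp (linear_map_comp (linear_map_comp linD' linS) linD)).
Qed.

(** The two entries of the square of the matrix [[S, C], [C, - S]]. *)
Let rotK1 x y : S (S x + C y) + C (C x - S y) = x.
Proof.
rewrite (linear_mapD linS) (linear_mapB linC) commSC.
by rewrite addrACA subrr addr0 sumSC.
Qed.

Let rotK2 x y : C (S x + C y) - S (C x - S y) = y.
Proof.
rewrite (linear_mapD linC) (linear_mapB linS) commSC.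
by rewrite opprB addrC addrA subrK sumSC.
Qed.

Lemma symmetryK : involutive M.
Proof.
by move=> z; elim/blk_ind: z => x y; rewrite !M_blk KD rotK1 rotK2 DK.
Qed.

Lemma symmetry_sym : symmetric_op M.
Proof.
move=> z z'; elim/blk_ind: z => x y; elim/blk_ind: z' => x' y'.
rewrite !M_blk !dotp_blk dotD' -dotD.
rewrite !(dotDl, dotDr, dotNl, dotNr) !symS !symC.
by rewrite -!addrA; congr (_ + _); rewrite addrCA.
Qed.

Lemma symmetry_intertwines z : M (P z) = Q (M z).
Proof.
elim/blk_ind: z => x y; rewrite proj_blk !M_blk Q_blk KD.
rewrite rotK1 (linear_map0 linD) (linear_map0 linS) (linear_map0 linC).
by rewrite subr0 addr0.
Qed.

Let unitaryM : unitary M.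
Proof.
apply: (@unitaryP _ _ _ M M) => //; [exact: symmetryK..|exact: symmetry_sym].
Qed.

Let MM : M \o M = idfun. Proof. by apply/funext => z; exact: symmetryK. Qed.
Let MP : M \o P = Q \o M.
Proof. by apply/funext => z; exact: symmetry_intertwines. Qed.

Let MQ : M \o Q = P \o M.
Proof.
apply/funext => z /=.
by rewrite -{1}[z]symmetryK -symmetry_intertwines symmetryK.
Qed.

Lemma outU_symmetry : outU Q P =
  [set M \o opmx V W U0 0 0 S0 | U0 in [set U : V -> V | unitary U]
                             & S0 in [set S : W -> W | unitary S]].
Proof.
apply/seteqP; split=> [U [uU UP]|_ [U0 uU0 [S0 uS0 <-]]].
  have uMU : unitary (M \o U) by exact: unitary_comp.
  have [|U0 [S0 [uU0 uS0 E]]] := unitary_commute_diag uMU.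
    by rewrite -compA UP compA MQ.
  exists U0 => //; exists S0 => //; rewrite -E compA MM; exact: funext.
split; first by exact: unitary_comp (opmx_diag_unitary _ _).
have [linU0 _ _ _ _] := unitary_adj uU0.
have [linS0 _ _ _ _] := unitary_adj uS0.
by rewrite -compA opmx_diag_commute// compA MP.
Qed.

Let contrS : contraction_op S. Proof. exact: sum_squares_contraction sumSC. Qed.
Let contrC : contraction_op C.
Proof.
by apply: (sum_squares_contraction symC symS) => x; rewrite addrC sumSC.
Qed.

Let CC x : C (C x) = x - S (S x).
Proof. by rewrite -{2}[x]sumSC addrAC subrr add0r. Qed.

Lemma commute_cos_sin (T : V -> V) : bounded_op T ->
  (forall x, T (S (S x)) = S (S (T x))) -> forall x, T (S (C x)) = S (C (T x)).
Proof.
move=> bT TSS x.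
rewrite (commute_sqrt posS contrS bT injS TSS).
rewrite (commute_sqrt posC contrC bT injC)// => y.
by rewrite !CC (linear_mapB bT.1) TSS.
Qed.

(** The upper corners of [V Q = Q V] give both conditions; [S C] cancels in the
off-diagonal one because it is injective. *)
Lemma diag_commute_Q U0 S0 : bounded_op U0 -> linear S0 ->
  opmx V W U0 0 0 S0 \o Q = Q \o opmx V W U0 0 0 S0 <->
  (forall x, U0 (S (S x)) = S (S (U0 x))) /\ S0 = adj D \o U0 \o D.
Proof.
move=> bU linS0; have linU := bU.1; have D0 := linear_map0 linD.
have S00 := linear_map0 linS; have C00 := linear_map0 linC.
split=> [/funeqP VQ|[USS S0E]].
  have {}VQ x y : opmx V W U0 0 0 S0 (Q (blk x y)) =
      Q (opmx V W U0 0 0 S0 (blk x y)) by exact: VQ.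
  have USS x : U0 (S (S x)) = S (S (U0 x)).
    have := VQ x 0; rewrite opmx_blk !Q_blk opmx_blk (linear_map0 linS0).
    by rewrite !addr0 !(D0, C00, addr0) => /blk_inj[].
  split=> //; apply/funext => y /=.
  have := VQ 0 y; rewrite opmx_blk !Q_blk opmx_blk (linear_map0 linU).
  rewrite S00 !(addr0, add0r) => /blk_inj[E _].
  rewrite commute_cos_sin// S00 add0r in E.
  rewrite -[LHS]DK; congr adj; apply/eqP; rewrite -subr_eq0; apply/eqP.
  by apply/injC/injS; rewrite (linear_mapB linC) (linear_mapB linS) E subrr.
have UC : forall x, U0 (C (C x)) = C (C (U0 x)).
  by move=> x; rewrite !CC (linear_mapB linU) USS.
have US := commute_sqrt posS contrS bU injS USS.
have {}UC := commute_sqrt posC contrC bU injC UC.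
apply: blk_ext => x y /=.
rewrite opmx_blk !Q_blk opmx_blk !(addr0, add0r) S0E /= !KD.
by rewrite !US !UC (linear_mapD linU) US UC.
Qed.

Lemma intU_symmetry : intU Q P =
  [set M \o opmx V W U0 0 0 (adj D \o U0 \o D) |
     U0 in [set U : V -> V | unitary U /\ U \o (S \o S) = (S \o S) \o U]].
Proof.
apply/seteqP; split=> [U [uU UP PU]|_ [U0 [uU0 /funeqP USS] <-]].
  have : outU Q P U by [].
  rewrite outU_symmetry => -[U0 uU0 [S0 uS0 UE]].
  have [linS0 _ _ _ _] := unitary_adj uS0.
  have bU0 : bounded_op U0 by case: uU0.
  have VQ : opmx V W U0 0 0 S0 \o Q = Q \o opmx V W U0 0 0 S0.
    have <- : M \o U = opmx V W U0 0 0 S0 by rewrite -UE compA MM.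
    by rewrite -[LHS]/(M \o (U \o Q)) -PU -[RHS]/((Q \o M) \o U) -MP.
  have [USS S0E] := (diag_commute_Q bU0 linS0).1 VQ.
  by exists U0; [split=> //; apply/funext | rewrite -S0E].
have uD' : unitary (adj D).
  exact: (@unitaryP _ _ _ _ D).
have uS0 := unitary_comp (unitary_comp uD' uU0) unitaryD.
have : outU Q P (M \o opmx V W U0 0 0 (adj D \o U0 \o D)).
  by rewrite outU_symmetry; exists U0 => //; eexists; first exact: uS0.
move=> [uU UP]; split=> //.
have [linS0 _ _ _ _] := unitary_adj uS0.
have bU0 : bounded_op U0 by case: uU0.
set V0 := opmx _ _ _ _ _ _.
have VQ : V0 \o Q = Q \o V0.
  by apply/(diag_commute_Q bU0 linS0); split=> // x; exact: USS.
by rewrite -[RHS]/(M \o (V0 \o Q)) VQ -[LHS]/((P \o M) \o V0) -MQ.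
Qed.

End SymmetryMatrix.

End Decomposition.

(** * The theorem *)

Unset Implicit Arguments.

Theorem theorem2p1 (R : realType) (H : hilbertType R) (P Q : H -> H)
    (H5 H6 : closedSubspace H) (Q0 : H5 -> H5) (D : H6 -> H5)
    (hP : orthogonal_projection P) (hQ : orthogonal_projection Q)
    (hPQ : generic_position P Q)
    (hH5 : subspace_set H5 = range P) (hH6 : subspace_set H6 = ker P)
    (hQ0pos : positive_op Q0) (hQ0contr : contraction_op Q0)
    (hQ0_0 : ~ op_eigenvalue Q0 0) (hQ0_1 : ~ op_eigenvalue Q0 1)
    (hD : unitary D)
    (Pmx : P = opmx H5 H6 idfun 0 0 0)
    (Qmx : Q = opmx H5 H6
       Q0 (sqrt_op Q0 \o sqrt_op (idfun - Q0) \o D)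
       (adj D \o sqrt_op Q0 \o sqrt_op (idfun - Q0))
       (adj D \o (idfun - Q0) \o D)) :
  let M := opmx H5 H6
    (sqrt_op Q0) (sqrt_op (idfun - Q0) \o D)
    (adj D \o sqrt_op (idfun - Q0)) (- (adj D \o sqrt_op Q0 \o D)) in
  outU Q P =
    [set M \o opmx H5 H6 U0 0 0 S0 | U0 in [set U : H5 -> H5 | unitary U]
                             & S0 in [set S : H6 -> H6 | unitary S]] /\
  intU Q P =
    [set M \o opmx H5 H6 U0 0 0 (adj D \o U0 \o D) |
       U0 in [set U : H5 -> H5 | unitary U /\ U \o Q0 = Q0 \o U]].
Proof.
move=> M.
set S := sqrt_op Q0; set C := sqrt_op (idfun - Q0).
have linQ0 : linear Q0 by case: hQ0pos => [[]].
have linQ : linear Q by case: hQ => [[]].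
have symQ : symmetric_op Q.
  by case: hQ => _ adjQ _; exact: selfadjoint_symmetric.
have [linD linD' DK KD dotD] := unitary_adj hD.
have Q_blk x y : Q (blk x y) = blk (Q0 x + S (C (D y)))
    (adj D (S (C x)) + adj D (D y - Q0 (D y))).
  by rewrite Qmx (opmx_blk hP hH5 hH6).
(* A constant [S C] vanishes, so [Q] is block diagonal and [Q0] is idempotent. *)
have H5_0 c : (forall x, S (C x) = c) -> forall x : H5, x = 0.
  move=> SC.
  have c0 : c = 0.
    have : Q (blk (0 : H5) (0 : H6)) = blk (0 : H5) (0 : H6).
      by rewrite blk0 (linear_map0 linQ).
    rewrite Q_blk => /(blk_inj hP hH5 hH6)[+ _].
    by rewrite SC (linear_map0 linQ0) add0r.
  have Q_diag x : Q (blk x (0 : H6)) = blk (Q0 x) (0 : H6).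
    rewrite Q_blk !SC c0 (linear_map0 linD) (linear_map0 linQ0) subr0.
    by rewrite (linear_map0 linD') !addr0.
  have QQ x : Q0 (Q0 x) = Q0 x.
    have : Q (Q (blk x (0 : H6))) = Q (blk x (0 : H6)).
      by case: hQ => _ _ /funeqP; exact.
    by rewrite !Q_diag => /(blk_inj hP hH5 hH6)[].
  move=> x; apply: contrapT => /eqP x0; apply: hQ0_1.
  exists x => //; rewrite scale1r; apply/eqP; rewrite -subr_eq0.
  apply/eqP; apply: contrapT => /eqP y0; apply: hQ0_0.
  by exists (Q0 x - x) => //; rewrite scale0r (linear_mapB linQ0) QQ subrr.
(* On the zero space all operators coincide, so each has a square root. *)
have trivial_sqrt (A : H5 -> H5) : (forall x : H5, x = 0) ->
    exists B, positive_op B /\ B \o B = A.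
  move=> H50; exists idfun; split; last first.
    by apply/funext => x; rewrite [LHS]H50 [RHS]H50.
  by split=> [|x]; [exact: isometry_bounded | exact: dotp_ge0].
have [posS SS] : positive_op S /\ S \o S = Q0.
  have [//|[noS [c Sc]]] := sqrt_op_cases Q0.
  by case: noS; apply/trivial_sqrt/(H5_0 c) => x; exact: Sc.
have [posC CC] : positive_op C /\ C \o C = idfun - Q0.
  have [//|[noC [c Cc]]] := sqrt_op_cases (idfun - Q0).
  case: noC; apply/trivial_sqrt/(H5_0 (S c)) => x; congr S; exact: Cc.
have SSx x : S (S x) = Q0 x by rewrite -SS.
have CCx x : C (C x) = x - Q0 x by rewrite -[LHS]/((C \o C) x) CC.
(* Compare the corners of [Q] and of its adjoint. *)
have commSC x : S (C x) = C (S x).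
  apply: dotp_inj => u; have := symQ (blk (0 : H5) (adj D u)) (blk x (0 : H6)).
  rewrite !Q_blk !(dotp_blk hP hH5 hH6) KD (linear_map0 linQ0) add0r.
  rewrite (linear_map0 linD) (linear_map0 linQ0) subr0 (linear_map0 linD').
  rewrite dot0r !addr0 -dotD KD.
  rewrite [dotp 0 _]dotC dot0r rmorph0 add0r => <-.
  by rewrite (positive_symmetric posS) (positive_symmetric posC).
have [linS linC] : linear S /\ linear C.
  by case: posS posC => [[? _] _] [[? _] _].
have injS x : S x = 0 -> x = 0.
  move=> Sx; apply: contrapT => /eqP x0; apply: hQ0_0.
  by exists x => //; rewrite scale0r -SSx Sx (linear_map0 linS).
have injC x : C x = 0 -> x = 0.
  move=> Cx; apply: contrapT => /eqP x0; apply: hQ0_1.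
  exists x => //; rewrite scale1r; apply/eqP; rewrite -subr_eq0 -opprB -CCx Cx.
  by rewrite (linear_map0 linC) oppr0.
have sumSC x : S (S x) + C (C x) = x by rewrite SSx CCx subrKC.
have QE : Q = opmx H5 H6 (S \o S) (S \o C \o D)
    (adj D \o S \o C) (adj D \o (C \o C) \o D) by rewrite SS CC.
split; first exact: (outU_symmetry hP hH5 hH6 posS posC sumSC commSC hD QE).
rewrite -SS.
exact: (intU_symmetry hP hH5 hH6 posS posC sumSC commSC injS injC hD QE).
Qed.
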